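(* Let $\approx$ be the congruence on the set $\mathcal{T}$ of types generated by a family of recursive equations $X_i \approx F_i$ ($i\in I$), where $F_i \in \mathcal{T}$, and assume that $\approx$ is good. Then every $\lambda$-term that is typable in the simply typed $\lambda$-calculus modulo $\approx$ is strongly normalizing: if $\Gamma \vdash M : T$ for some context $\Gamma$ and some type $T$, then there is no infinite $\rhd$-reduction sequence starting from $M$.
   Context: Terms. Let $\mathcal{V}$ be an infinite set of variables. $\lambda$-terms are given by $\mathcal{M} ::= \mathcal{V} \mid \lambda \mathcal{V}\,\mathcal{M} \mid (\mathcal{M}\;\mathcal{M})$, up to renaming of bound variables. The relation $\rhd$ is the least relation on terms compatible with contexts (i.e. reduction is allowed in any subterm) containing $(\lambda x\, M\; N) \rhd M[x:=N]$. Types. Let $\mathcal{A}$ be a set of atomic constants and $\mathcal{X}=\{X_i : i\in I\}$ a set of type variables. Types are given by $\mathcal{T} ::= \mathcal{A} \mid \mathcal{X} \mid \mathcal{T}\to\mathcal{T}$. Given types $F_i$ ($i \in I$), the congruence $\approx$ generated by $E=\{F_i : i\in I\}$ is the least congruence on $\mathcal{T}$ (equivalence relation compatible with $\to$) such that $X_i\approx F_i$ for each $i\in I$. Polarity. For $X\in\mathcal{X}$, the sets $\mathcal{T}^+(X),\mathcal{T}^-(X)\subseteq\mathcal{T}$ are defined inductively by: $X\in\mathcal{T}^+(X)$; if $U\in(\mathcal{X}\setminus\{X\})\cup\mathcal{A}$ then $U\in\mathcal{T}^+(X)\cap\mathcal{T}^-(X)$; if $U\in\mathcal{T}^-(X)$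 and $V\in\mathcal{T}^+(X)$, then $U\to V\in\mathcal{T}^+(X)$ and $V\to U\in\mathcal{T}^-(X)$. The congruence $\approx$ is good if, for each $X\in\mathcal{X}$ and each type $T$, $X\approx T$ implies $T\in\mathcal{T}^+(X)$. Typing rules ($\Gamma$ is a context, i.e. a set of declarations $x:U$ with $x \in \mathcal{V}$, $U\in\mathcal{T}$): (ax) $\Gamma,x:U\vdash x:U$; ($\approx$) from $\Gamma\vdash M:U$ and $U\approx V$ infer $\Gamma\vdash M:V$; ($\to_i$) from $\Gamma,x:U\vdash M:V$ infer $\Gamma\vdash\lambda x\,M:U\to V$; ($\to_e$) from $\Gamma\vdash M_1:U\to V$ and $\Gamma\vdash M_2:U$ infer $\Gamma\vdash(M_1\;M_2):V$. *)

(* Defs.v *)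
Set Implicit Arguments.

(* Terms up to renaming of bound variables are represented by de Bruijn
   indices: an index that exceeds the number of enclosing abstractions by k
   denotes the k-th free variable. *)
Inductive term : Type :=
| Var (n : nat)
| Lam (M : term)
| App (M N : term).

Definition up_ren (r : nat -> nat) (n : nat) : nat :=
  match n with
  | 0 => 0
  | S m => S (r m)
  end.

Fixpoint rename (r : nat -> nat) (M : term) : term :=
  match M with
  | Var n => Var (r n)
  | Lam M => Lam (rename (up_ren r) M)
  | App M N => App (rename r M) (rename r N)
  end.

Definition up_subst (s : nat -> term) (n : nat) : term :=
  match n with
  | 0 => Var 0
  | S m => rename S (s m)
  end.

(* Simultaneous capture-avoiding substitution of [s n] for each free [n]. *)
Fixpoint subst (s : nat -> term) (M : term) : term :=
  match M with
  | Var n => s n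
  | Lam M => Lam (subst (up_subst s) M)
  | App M N => App (subst s M) (subst s N)
  end.

(* [subst1 N M] is M[x:=N], where x is the variable of index 0 in M, bound by
   the abstraction that a beta-step removes; hence the shift of the others. *)
Definition subst1 (N M : term) : term :=
  subst (fun n => match n with 0 => N | S m => Var m end) M.

Inductive red : term -> term -> Prop :=
| red_beta M N : red (App (Lam M) N) (subst1 N M)
| red_lam M M' : red M M' -> red (Lam M) (Lam M')
| red_appl M M' N : red M M' -> red (App M N) (App M' N)
| red_appr M N N' : red N N' -> red (App M N) (App M N').

Definition strongly_normalizing (M : term) : Prop :=
  ~ exists f : nat -> term, f 0 = M /\ forall n, red (f n) (f (S n)).

(* [TVar i] is the type variable X_i; there is exactly one for each [i : I]. *)
Inductive type (A I : Type) : Type :=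
| TConst (a : A)
| TVar (i : I)
| Arrow (U V : type A I).

Arguments TConst {A I} a.
Arguments TVar {A I} i.

Inductive cong (A I : Type) (F : I -> type A I) :
    type A I -> type A I -> Prop :=
| cong_eq i : cong F (TVar i) (F i)
| cong_refl U : cong F U U
| cong_sym U V : cong F U V -> cong F V U
| cong_trans U V W : cong F U V -> cong F V W -> cong F U W
| cong_arrow U U' V V' :
    cong F U U' -> cong F V V' -> cong F (Arrow U V) (Arrow U' V').

(* [tpos i] and [tneg i] are T^+(X_i) and T^-(X_i). *)
Inductive tpos (A I : Type) (i : I) : type A I -> Prop :=
| tpos_self : tpos i (TVar i)
| tpos_var j : j <> i -> tpos i (TVar j)
| tpos_const a : tpos i (TConst a)
| tpos_arrow U V : tneg i U -> tpos i V -> tpos i (Arrow U V)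
with tneg (A I : Type) (i : I) : type A I -> Prop :=
| tneg_var j : j <> i -> tneg i (TVar j)
| tneg_const a : tneg i (TConst a)
| tneg_arrow U V : tneg i U -> tpos i V -> tneg i (Arrow V U).

Definition good (A I : Type) (F : I -> type A I) : Prop :=
  forall (i : I) (T : type A I), cong F (TVar i) T -> tpos i T.

(* A possibly infinite set of declarations, at most one per variable. *)
Definition context (A I : Type) : Type := nat -> option (type A I).

(* The freshly bound variable gets index 0, the declared ones are shifted. *)
Definition extend (A I : Type) (G : context A I) (U : type A I) :
    context A I :=
  fun n => match n with 0 => Some U | S m => G m end.

Inductive typing (A I : Type) (F : I -> type A I) :
    context A I -> term -> type A I -> Prop :=
| typing_ax G n U : G n = Some U -> typing F G (Var n) U
| typing_cong G M U V : typing F G M U -> cong F U V -> typing F G M V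
| typing_lam G M U V :
    typing F (extend G U) M V -> typing F G (Lam M) (Arrow U V)
| typing_app G M N U V :
    typing F G M (Arrow U V) -> typing F G N U -> typing F G (App M N) V.

(* Main.v *)
Require Import Defs.
From Stdlib Require Import List Bool ClassicalEpsilon.

Set Implicit Arguments.

(** A typing derivation uses finitely many equations, and goodness is inherited
    by subsets of the equations, so it suffices to interpret types by
    reducibility candidates satisfying a finite good system.  The variables are
    solved one at a time, as functions of the remaining ones: the new variable
    is a least fixed point of its equation, in which the already solved
    variables have been replaced by their solutions.  The invariant carried
    along is that the solution of a type depends monotonically (antitonically)
    on a parameter as soon as no congruent type has a negative (positive)
    occurrence of it; goodness then makes the operator of the new variable
    monotone. *)

(** * Substitution and reduction *)

Lemma rename_ext M r r' : (forall n, r n = r' n) -> rename r M = rename r' M.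
Proof.
  revert r r'; induction M as [n|M IH|M IHM N IHN]; simpl; intros r r' H.
  - now rewrite H.
  - f_equal; apply IH; intros [|n]; simpl; auto.
  - f_equal; auto.
Qed.

Lemma subst_ext M s s' : (forall n, s n = s' n) -> subst s M = subst s' M.
Proof.
  revert s s'; induction M as [n|M IH|M IHM N IHN]; simpl; intros s s' H.
  - apply H.
  - f_equal; apply IH; intros [|n]; simpl; auto; now rewrite H.
  - f_equal; auto.
Qed.

Lemma subst_Var M : subst Var M = M.
Proof.
  induction M as [n|M IH|M IHM N IHN]; simpl; f_equal; auto.
  rewrite <- IH at 2; apply subst_ext; intros [|n]; reflexivity.
Qed.

Lemma rename_rename M r r' :
  rename r' (rename r M) = rename (fun n => r' (r n)) M.
Proof.
  revert r r'; induction M as [n|M IH|M IHM N IHN]; simpl; intros r r'; f_equal; auto.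
  rewrite IH; apply rename_ext; intros [|n]; reflexivity.
Qed.

Lemma subst_rename M r s : subst s (rename r M) = subst (fun n => s (r n)) M.
Proof.
  revert r s; induction M as [n|M IH|M IHM N IHN]; simpl; intros r s; f_equal; auto.
  rewrite IH; apply subst_ext; intros [|n]; reflexivity.
Qed.

Lemma rename_subst M r s :
  rename r (subst s M) = subst (fun n => rename r (s n)) M.
Proof.
  revert r s; induction M as [n|M IH|M IHM N IHN]; simpl; intros r s; f_equal; auto.
  rewrite IH; apply subst_ext; intros [|n]; simpl; auto.
  now rewrite !rename_rename.
Qed.

Lemma subst_subst M s s' :
  subst s' (subst s M) = subst (fun n => subst s' (s n)) M.
Proof.
  revert s s'; induction M as [n|M IH|M IHM N IHN]; simpl; intros s s'; f_equal; auto.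
  rewrite IH; apply subst_ext; intros [|n]; simpl; auto.
  now rewrite subst_rename, rename_subst.
Qed.

Definition scons (N : term) (s : nat -> term) (n : nat) : term :=
  match n with 0 => N | S m => s m end.

Lemma subst1_up_subst N M s :
  subst1 N (subst (up_subst s) M) = subst (scons N s) M.
Proof.
  unfold subst1; rewrite subst_subst; apply subst_ext; intros [|n]; simpl; auto.
  now rewrite subst_rename, subst_Var.
Qed.

Lemma subst_subst1 N M s :
  subst s (subst1 N M) = subst1 (subst s N) (subst (up_subst s) M).
Proof.
  rewrite subst1_up_subst; unfold subst1; rewrite subst_subst.
  apply subst_ext; intros [|n]; reflexivity.
Qed.

Lemma red_subst M M' s : red M M' -> red (subst s M) (subst s M').
Proof.
  intros H; revert s; induction H; simpl; intros s; try (constructor; auto; fail).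
  rewrite subst_subst1; constructor.
Qed.

(** * Reducibility candidates *)

(** The accessibility form gives induction on one-step reducts. *)
Definition sn : term -> Prop := Acc (fun N M => red M N).

Lemma sn_preimage (f : term -> term) M :
  (forall N N', red N N' -> red (f N) (f N')) -> sn (f M) -> sn M.
Proof.
  intros Hf H; remember (f M) as P eqn:E; revert M E.
  induction H as [P _ IH]; intros M ->; constructor; intros N HN.
  exact (IH _ (Hf _ _ HN) _ eq_refl).
Qed.

Lemma sn_strongly_normalizing M : sn M -> strongly_normalizing M.
Proof.
  intros H; induction H as [M _ IH]; intros (f & <- & Hf).
  apply (IH (f 1) (Hf 0)); exists (fun n => f (S n)); auto.
Qed.

Definition neutral (M : term) : Prop :=
  match M with Lam _ => False | _ => True end.

(** Girard's conditions CR1 to CR3. For a variable the premise of the third is vacuous, so every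
    candidate contains all variables. *)
Record candidate (P : term -> Prop) : Prop := {
  candidate_sn : forall M, P M -> sn M;
  candidate_red : forall M N, P M -> red M N -> P N;
  candidate_neutral :
    forall M, neutral M -> (forall N, red M N -> P N) -> P M }.

Definition included (P Q : term -> Prop) : Prop := forall M, P M -> Q M.

Definition arrow (P Q : term -> Prop) (M : term) : Prop :=
  forall N, P N -> Q (App M N).

Lemma candidate_Var P n : candidate P -> P (Var n).
Proof. intros HP; apply (candidate_neutral HP); simpl; auto; intros N H; inversion H. Qed.

Lemma sn_candidate : candidate sn.
Proof.
  split; auto.
  - intros M N [H] HN; exact (H _ HN).
  - intros M _ H; constructor; exact H.
Qed.

Lemma arrow_candidate P Q : candidate P -> candidate Q -> candidate (arrow P Q).
Proof.
  intros HP HQ; split.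
  - intros M HM; apply (sn_preimage (fun M => App M (Var 0))).
    + intros; now constructor.
    + apply (candidate_sn HQ), HM, candidate_Var, HP.
  - intros M N HM HR L HL; apply (candidate_red HQ) with (App M L); auto.
    now constructor.
  (* Induction on the reductions of the argument; since [M] is neutral, the application is not
     itself a redex. *)
  - intros M Hn HM N HN; assert (Hsn := candidate_sn HP _ HN).
    induction Hsn as [N _ IH]; apply (candidate_neutral HQ); simpl; auto.
    intros L HL; inversion HL; subst.
    + destruct Hn.
    + now apply HM.
    + apply IH; auto; eapply candidate_red; eauto.
Qed.

Lemma arrow_Lam P Q M :
  candidate P -> candidate Q -> (forall N, P N -> Q (subst1 N M)) ->
  arrow P Q (Lam M).
Proof.
  intros HP HQ HM.
  (* Instantiating the bound variable by a variable, which lies in [P], yields a term of [Q];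
     reductions of [M] carry over to it. Nested inductions on [M] and [N] then treat the reducts of
     the redex. *)
  assert (HsM : sn M).
  { apply (sn_preimage (subst1 (Var 0))).
    - intros; now apply red_subst.
    - apply (candidate_sn HQ), HM, candidate_Var, HP. }
  induction HsM as [M _ IHM]; intros N HN.
  assert (HsN := candidate_sn HP _ HN); induction HsN as [N _ IHN].
  apply (candidate_neutral HQ); simpl; auto.
  intros L HL; inversion HL as [ | |? ? ? HR|? ? ? HR]; subst.
  - auto.
  - inversion HR as [ |? L HR'| |]; subst; apply IHM; auto.
    intros K HK; apply (candidate_red HQ) with (subst1 K M); auto.
    now apply red_subst.
  - apply IHN; auto; eapply candidate_red; eauto.
Qed.

(** Knaster-Tarski: the intersection of the candidates closed under [Phi]. When [Phi] preserves
    candidates, [sn] is one of them, as every candidate consists of [sn] terms. *)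
Definition lfp (Phi : (term -> Prop) -> term -> Prop) (M : term) : Prop :=
  forall P, candidate P -> included (Phi P) P -> P M.

Lemma lfp_candidate Phi :
  (forall P, candidate P -> candidate (Phi P)) -> candidate (lfp Phi).
Proof.
  intros HPhi; split.
  - intros M HM; apply (HM sn); [apply sn_candidate|].
    exact (candidate_sn (HPhi _ sn_candidate)).
  - intros M N HM HR P HP HI; exact (candidate_red HP (HM P HP HI) HR).
  - intros M Hn HM P HP HI; apply (candidate_neutral HP); auto.
    intros N HN; exact (HM N HN P HP HI).
Qed.

Section LeastFixedPoint.

Variable Phi : (term -> Prop) -> term -> Prop.
Hypothesis Phi_candidate : forall P, candidate P -> candidate (Phi P).
Hypothesis Phi_monotone : forall P Q,
  candidate P -> candidate Q -> included P Q -> included (Phi P) (Phi Q).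

Lemma lfp_prefixed : included (Phi (lfp Phi)) (lfp Phi).
Proof.
  intros M HM P HP HI; apply HI.
  revert M HM; apply Phi_monotone; auto using lfp_candidate.
  intros M HM; apply HM; auto.
Qed.

Lemma lfp_postfixed : included (lfp Phi) (Phi (lfp Phi)).
Proof.
  (* By monotonicity [Phi (lfp Phi)] is itself a candidate closed under [Phi]. *)
  intros M HM; apply HM; auto using lfp_candidate.
  apply Phi_monotone; auto using lfp_candidate, lfp_prefixed.
Qed.

End LeastFixedPoint.

(** * Signed dependency of a type on a variable *)

Section Types.

Variables A I : Type.
Implicit Types (T U V : type A I) (F : I -> type A I) (b c : bool).

(** The boolean is the sign of the occurrence, [true] meaning positive. *)
Inductive occurs (i : I) : bool -> type A I -> Prop :=
| occurs_var : occurs i true (TVar i)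
| occurs_left b U V : occurs i (negb b) U -> occurs i b (Arrow U V)
| occurs_right b U V : occurs i b V -> occurs i b (Arrow U V).

Lemma tpos_tneg_not_occurs i T :
  (tpos i T -> ~ occurs i false T) /\ (tneg i T -> ~ occurs i true T).
Proof.
  induction T as [a|j|U [IHUp IHUn] V [IHVp IHVn]]; split; intros H Ho;
    inversion Ho; subst; inversion H; subst; simpl in *; try congruence; firstorder.
Qed.

Lemma cong_incl F F' :
  (forall i, cong F' (TVar i) (F i)) ->
  forall U V, cong F U V -> cong F' U V.
Proof.
  intros HF U V H; induction H; eauto using cong_refl, cong_sym, cong_trans, cong_arrow.
Qed.

Lemma typing_incl F F' :
  (forall U V, cong F U V -> cong F' U V) ->
  forall G M T, typing F G M T -> typing F' G M T.
Proof.
  intros HF G M T H; induction H; eauto using typing.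
Qed.

(** Occurrences are counted up to congruence because some appear only after unfolding equations. *)
Definition depends F b (i : I) T : Prop :=
  exists T', cong F T T' /\ occurs i b T'.

Lemma depends_var F i : depends F true i (TVar i).
Proof. exists (TVar i); split; constructor. Qed.

Lemma depends_cong F b i T T' :
  cong F T T' -> depends F b i T' -> depends F b i T.
Proof. intros H (V & HV & Ho); exists V; eauto using cong_refl, cong_sym, cong_trans, cong_arrow. Qed.

Lemma depends_left F b i U V :
  depends F (negb b) i U -> depends F b i (Arrow U V).
Proof.
  intros (U' & HU & Ho); exists (Arrow U' V); split.
  - apply cong_arrow; auto using cong_refl.
  - now apply occurs_left.
Qed.

Lemma depends_right F b i U V :
  depends F b i V -> depends F b i (Arrow U V).
Proof.
  intros (V' & HV & Ho); exists (Arrow U V'); split.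
  - apply cong_arrow; auto using cong_refl.
  - now apply occurs_right.
Qed.

Lemma depends_incl F F' b i T :
  (forall U V, cong F U V -> cong F' U V) ->
  depends F b i T -> depends F' b i T.
Proof. intros H (V & HV & Ho); exists V; auto. Qed.

(** The occurrence of [i] is replaced by a congruent type in which [j] occurs; signs multiply, and
    [eqb] is their product. *)
Lemma depends_trans F b c i j T :
  depends F b i T -> depends F c j (TVar i) -> depends F (eqb b c) j T.
Proof.
  intros (T' & HT & Ho) Hd; apply depends_cong with T'; auto; clear HT.
  induction Ho as [|b U V _ IH|b U V _ IH].
  - now destruct c.
  - apply depends_left; now destruct b, c.
  - now apply depends_right.
Qed.

(** The only form in which goodness enters the construction. *)
Lemma good_not_depends F i : good F -> ~ depends F false i (TVar i).
Proof.
  intros Hg (T & HT & Ho).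
  exact (proj1 (tpos_tneg_not_occurs i T) (Hg _ _ HT) Ho).
Qed.

(** * Finite subsystems *)

(* A trivial equation [X_j = X_j] amounts to no equation, so that [cong] and
   [typing] also serve for the subsystem of the equations in [S]. *)
Definition restrict F (S : list I) (j : I) : type A I :=
  if excluded_middle_informative (In j S) then F j else TVar j.

Lemma restrict_In F S j : In j S -> restrict F S j = F j.
Proof. unfold restrict; now destruct excluded_middle_informative. Qed.

Lemma cong_restrict_In F S j : In j S -> cong (restrict F S) (TVar j) (F j).
Proof. intros Hj; rewrite <- (restrict_In F S j Hj); constructor. Qed.

Lemma restrict_cong F S U V : cong (restrict F S) U V -> cong F U V.
Proof.
  apply cong_incl; intros j; unfold restrict.
  destruct excluded_middle_informative; constructor.
Qed.

Lemma restrict_cong_incl F S S' U V :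
  incl S S' -> cong (restrict F S) U V -> cong (restrict F S') U V.
Proof.
  intros HS; apply cong_incl; intros j; unfold restrict at 2.
  destruct excluded_middle_informative as [Hj|]; [|constructor].
  now apply cong_restrict_In, HS.
Qed.

Lemma cong_finite F U V :
  cong F U V -> exists S, cong (restrict F S) U V.
Proof.
  intros H; induction H as [i|U|U V _ [S IH]|U V W _ [S IH] _ [S' IH']
                           |U U' V V' _ [S IH] _ [S' IH']].
  - exists (i :: nil); apply cong_restrict_In; now left.
  - exists nil; constructor.
  - exists S; now constructor.
  - exists (S ++ S'); apply cong_trans with V;
      (eapply restrict_cong_incl; [|eassumption]; auto using incl_appl, incl_appr, incl_refl).
  - exists (S ++ S'); apply cong_arrow;
      (eapply restrict_cong_incl; [|eassumption]; auto using incl_appl, incl_appr, incl_refl).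
Qed.

Lemma restrict_typing_incl F S S' G M T :
  incl S S' -> typing (restrict F S) G M T -> typing (restrict F S') G M T.
Proof. intros HS; apply typing_incl; intros U V; now apply restrict_cong_incl. Qed.

Lemma typing_finite F G M T :
  typing F G M T -> exists S, typing (restrict F S) G M T.
Proof.
  intros H; induction H as [G n U HG|G M U V _ [S IH] HUV|G M U V _ [S IH]
                           |G M N U V _ [S IH] _ [S' IH']].
  - exists nil; now constructor.
  - destruct (cong_finite HUV) as [S' HS']; exists (S ++ S').
    apply typing_cong with U.
    + (eapply restrict_typing_incl; [|eassumption]; auto using incl_appl, incl_refl).
    + (eapply restrict_cong_incl; [|eassumption]; auto using incl_appr, incl_refl).
  - exists S; now constructor.
  - exists (S ++ S'); apply typing_app with U;
      (eapply restrict_typing_incl; [|eassumption]; auto using incl_appl, incl_appr, incl_refl).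
Qed.

(** * Interpretation of types *)

Definition valuation : Type := I -> term -> Prop.
Implicit Types rho : valuation.

Definition valid rho : Prop := forall i, candidate (rho i).

Fixpoint interp rho T : term -> Prop :=
  match T with
  | TConst _ => sn
  | TVar i => rho i
  | Arrow U V => arrow (interp rho U) (interp rho V)
  end.

Lemma interp_candidate rho T : valid rho -> candidate (interp rho T).
Proof.
  intros Hr; induction T; simpl; auto using sn_candidate, arrow_candidate.
Qed.

Definition solution F rho : Prop :=
  forall i M, rho i M <-> interp rho (F i) M.

Lemma interp_cong F rho U V :
  solution F rho -> cong F U V -> forall M, interp rho U M <-> interp rho V M.
Proof.
  intros Hs H; induction H as [i| | |U V W _ IH _ IH'|U U' V V' _ IH _ IH'];
    intros M; simpl.
  - apply Hs.
  - tauto.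
  - now symmetry.
  - now rewrite IH.
  - split; intros HM N HN; apply IH', HM, IH, HN.
Qed.

Lemma interp_adequate F rho G M T :
  valid rho -> solution F rho -> typing F G M T ->
  forall s, (forall n U, G n = Some U -> interp rho U (s n)) ->
  interp rho T (subst s M).
Proof.
  intros Hv Hs H; induction H as [G n U HG|G M U V _ IH HUV|G M U V _ IH
                                 |G M N U V _ IH _ IH']; simpl; intros s Hg.
  - auto.
  - apply (interp_cong Hs HUV); auto.
  - apply arrow_Lam; auto using interp_candidate.
    intros N HN; rewrite subst1_up_subst; apply IH.
    intros [|n] W; simpl; auto; now intros [= <-].
  - apply (IH s Hg), IH', Hg.
Qed.

(** * Monotone solutions of finite systems *)

Definition signed_included b (P Q : term -> Prop) : Prop :=
  if b then included P Q else included Q P.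

(** The preorder on valuations seen by [T]: a dependency of both signs forces the two values to
    coincide, and no dependency imposes nothing. *)
Definition below F T rho rho' : Prop :=
  forall i b, depends F b i T -> signed_included b (rho i) (rho' i).

Lemma below_left F U V rho rho' :
  below F (Arrow U V) rho rho' -> below F U rho' rho.
Proof.
  intros H i b Hd.
  rewrite <- (negb_involutive b) in Hd.
  assert (H' := H i (negb b) (depends_left _ V Hd)); now destruct b.
Qed.

Lemma below_right F U V rho rho' :
  below F (Arrow U V) rho rho' -> below F V rho rho'.
Proof. intros H i b Hd; apply H; now apply depends_right. Qed.

Lemma below_dependency F b i T rho rho' :
  below F T rho rho' -> depends F b i T ->
  if b then below F (TVar i) rho rho' else below F (TVar i) rho' rho.
Proof.
  intros H Hd; destruct b; intros j c Hc; assert (H' := H _ _ (depends_trans Hd Hc));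
    now destruct c.
Qed.

Record solver F (S : list I) (sol : valuation -> valuation) : Prop := {
  solver_valid : forall rho, valid rho -> valid (sol rho);
  solver_parameter : forall rho j, ~ In j S -> sol rho j = rho j;
  solver_solution : forall rho, valid rho -> solution (restrict F S) (sol rho);
  solver_monotone : forall rho rho' j, valid rho -> valid rho' ->
    below (restrict F S) (TVar j) rho rho' -> included (sol rho j) (sol rho' j) }.

Lemma solver_interp_monotone F S sol T rho rho' :
  solver F S sol -> valid rho -> valid rho' ->
  below (restrict F S) T rho rho' ->
  included (interp (sol rho) T) (interp (sol rho') T).
Proof.
  intros Hsol; revert rho rho'.
  induction T as [a|j|U IHU V IHV]; simpl; intros rho rho' Hr Hr' Hb.
  - now intros M HM.
  - eapply solver_monotone; eauto.
  - intros M HM N HN.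
    apply (IHV _ _ Hr Hr' (below_right Hb)), HM, (IHU _ _ Hr' Hr (below_left Hb)), HN.
Qed.

Definition update rho (i : I) (P : term -> Prop) : valuation :=
  fun j => if excluded_middle_informative (j = i) then P else rho j.

Lemma update_valid rho i P : valid rho -> candidate P -> valid (update rho i P).
Proof.
  intros Hr HP j; unfold update; destruct excluded_middle_informative; auto.
Qed.

Lemma update_same rho i P : update rho i P i = P.
Proof. unfold update; destruct excluded_middle_informative; congruence. Qed.

Lemma update_other rho i j P : j <> i -> update rho i P j = rho j.
Proof. unfold update; destruct excluded_middle_informative; congruence. Qed.

(** * Solving for one more variable *)

Section Extension.

Variables (F : I -> type A I) (S : list I) (sol : valuation -> valuation) (i : I).
Hypothesis F_good : good F.
Hypothesis sol_solver : solver F S sol.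
Hypothesis i_fresh : ~ In i S.

(** A fixed point in [P] solves the equation of [i] once those of [S] are solved with [P] as the
    value of [i]. *)
Definition operator rho P := interp (sol (update rho i P)) (F i).

Lemma operator_candidate rho P : valid rho -> candidate P -> candidate (operator rho P).
Proof.
  intros Hr HP; apply interp_candidate, (solver_valid sol_solver).
  now apply update_valid.
Qed.

Lemma operator_monotone rho P Q :
  valid rho -> candidate P -> candidate Q -> included P Q ->
  included (operator rho P) (operator rho Q).
Proof.
  intros Hr HP HQ HPQ.
  apply (solver_interp_monotone sol_solver); auto using update_valid.
  intros j b Hd; unfold update.
  destruct excluded_middle_informative as [->|].
  - destruct b; auto.
    (* The two valuations differ only at [i], and [F i] is congruent to [TVar i], so goodness
       excludes a negative dependency. *)
    destruct (good_not_depends (i := i) F_good).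
    apply depends_cong with (F i); [constructor|].
    revert Hd; apply depends_incl, restrict_cong.
  - destruct b; now intros M.
Qed.

Lemma depends_tail b j T :
  depends (restrict F S) b j T -> depends (restrict F (i :: S)) b j T.
Proof.
  apply depends_incl; intros U V; apply restrict_cong_incl, incl_tl, incl_refl.
Qed.

(** Every candidate closed under [operator rho'] is closed under [operator rho]: at [i] both
    valuations take the same value, elsewhere they are compared through [F i]. *)
Lemma lfp_monotone rho rho' :
  valid rho -> valid rho' ->
  below (restrict F (i :: S)) (TVar i) rho rho' ->
  included (lfp (operator rho)) (lfp (operator rho')).
Proof.
  intros Hr Hr' Hb M HM P HP HI; apply HM; auto.
  intros N HN; apply HI; revert N HN.
  apply (solver_interp_monotone sol_solver); auto using update_valid.
  intros j b Hd; unfold update.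
  destruct excluded_middle_informative as [->|].
  - destruct b; now intros M'.
  - apply Hb, depends_cong with (F i); [apply cong_restrict_In; now left|].
    now apply depends_tail.
Qed.

Lemma solver_extend :
  solver F (i :: S) (fun rho => sol (update rho i (lfp (operator rho)))).
Proof.
  assert (Hv : forall rho, valid rho -> valid (update rho i (lfp (operator rho)))).
  { intros rho Hr; apply update_valid, lfp_candidate; auto.
    intros; now apply operator_candidate. }
  split.
  - intros rho Hr; now apply (solver_valid sol_solver), Hv.
  - intros rho j Hj; rewrite (solver_parameter sol_solver).
    + apply update_other; intros ->; apply Hj; now left.
    + intros H; apply Hj; now right.
  - intros rho Hr j M; unfold restrict.
    destruct excluded_middle_informative as [[<-|Hj]|].
    (* As [i] is not in [S], [sol] leaves its value unchanged, and the equation of [i] becomes the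
       fixed point equation. *)
    + rewrite (solver_parameter sol_solver), update_same by auto.
      fold (operator rho (lfp (operator rho))).
      split; [apply lfp_postfixed|apply lfp_prefixed];
        auto using operator_candidate, operator_monotone.
    + rewrite (solver_solution sol_solver (Hv _ Hr) j M); unfold restrict.
      destruct excluded_middle_informative; tauto.
    + reflexivity.
  - intros rho rho' j Hr Hr' Hb.
    apply (solver_monotone sol_solver); auto.
    intros k b Hd; apply depends_tail in Hd; unfold update.
    destruct excluded_middle_informative as [->|]; auto.
    (* The sign of the dependency of [j] on [i] decides the direction in which the two fixed points
       are compared. *)
    assert (H := below_dependency Hb Hd).
    destruct b; now apply lfp_monotone.
Qed.

End Extension.

Lemma solver_exists F S : good F -> exists sol, solver F S sol.
Proof.
  intros Hg; induction S as [|i S [sol Hsol]].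
  - exists (fun rho => rho); split; auto.
    + intros rho _ j M; unfold restrict.
      destruct excluded_middle_informative as [[]|]; reflexivity.
    + intros rho rho' j _ _ Hb; apply (Hb j true), depends_var.
  - destruct (classic (In i S)) as [Hi|Hi].
    (* A repeated index adds no equation: both lists generate the same congruence, so [sol] is
       kept. *)
    + assert (Hincl : incl (i :: S) S) by (apply incl_cons; auto using incl_refl).
      exists sol; split.
      * apply (solver_valid Hsol).
      * intros rho j Hj; apply (solver_parameter Hsol); auto using in_cons.
      * intros rho Hr j M.
        change (sol rho j) with (interp (sol rho) (TVar j)).
        apply (interp_cong (solver_solution Hsol Hr)), (restrict_cong_incl Hincl).
        apply cong_eq.
      * intros rho rho' j Hr Hr' Hb; apply (solver_monotone Hsol); auto.
        intros k b Hd; apply Hb; revert Hd; apply depends_incl.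
        intros U V; apply restrict_cong_incl, incl_tl, incl_refl.
    + eexists; exact (solver_extend i Hg Hsol Hi).
Qed.

End Types.

Theorem mainTheorem1 (A I : Type) (F : I -> type A I) (Hgood : good F)
    (G : context A I) (M : term) (T : type A I) (HM : typing F G M T) :
  strongly_normalizing M.
Proof.
  destruct (typing_finite HM) as [S HS].
  destruct (solver_exists S Hgood) as [sol Hsol].
  assert (Hsn : valid (fun _ : I => sn)) by (intros i; apply sn_candidate).
  assert (Hv := solver_valid Hsol Hsn).
  apply sn_strongly_normalizing.
  apply (candidate_sn (interp_candidate T Hv)).
  (* The identity substitution is admissible because candidates contain the variables. *)
  rewrite <- (subst_Var M).
  apply (interp_adequate Hv (solver_solution Hsol Hsn) HS).
  intros n U _; now apply candidate_Var, interp_candidate.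
Qed.
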